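(* Let $1\le k<d\le n$. Let $D^{MA}$ be the dictionary of size $d$ selected by the algorithm $\mathrm{SDS}_{\mathrm{MA}}$, and let $D^*$ be an optimum dictionary, i.e. a set $D\subseteq V$ with $|D|\le d$ maximizing $F(D)$. Then $$F(D^{MA})\;\ge\;\frac{\gamma_{\emptyset,k}}{\lambda_{\max}(C,k)}\Bigl(1-\frac1e\Bigr)\cdot F(D^* )\;\ge\;\frac{\lambda_{\min}(C,k)}{\lambda_{\max}(C,k)}\Bigl(1-\frac1e\Bigr)\cdot F(D^* ).$$
   Context: Setting: $Z_1,\dots,Z_s$ and $V=\{X_1,\dots,X_n\}$ are real random variables with mean $0$ and variance $1$. $C=(\mathrm{Cov}(X_i,X_{i'}))_{i,i'}$ is the covariance matrix of the $X_i$; for $S\subseteq V$ (identified with its index set), $C_S$ is the submatrix with rows and columns in $S$. It is assumed throughout that $C$, and hence every $C_S$, is non-singular. For a variable $Z$ and $S\subseteq V$, the squared multiple correlation is $R^2_{Z,S}=1-\min_{\alpha}E[(Z-\sum_{i\in S}\alpha_iX_i)^2]=\mathbf b_S^{T}C_S^{-1}\mathbf b_S$, where $\mathbf b_S=(\mathrm{Cov}(Z,X_i))_{i\in S}$ (and $R^2_{Z,\emptyset}=0$). Dictionary selection objective: $F(D)=\sum_{j=1}^s\max_{S\subseteq D,|S|=k}R^2_{Z_j,S}$ for $D\subseteq V$. Its modular approximation is $\hat F(D)=\sum_{j=1}^s\max_{S\subseteq D,|S|=k}\sum_{i\in S}R^2_{Z_j,\{X_i\}}$. When $|D|<k$, the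 maxima are taken over $S\subseteq D$ with $|S|\le k$. $\mathrm{SDS}_{\mathrm{MA}}$: start with $D_0=\emptyset$; in iteration $i+1$ choose $X_m\in V\setminus D_i$ maximizing $\hat F(D_i\cup\{X_m\})$ (ties arbitrary) and set $D_{i+1}=D_i\cup\{X_m\}$; output $D_d$. Submodularity ratio with $U=\emptyset$: for a single target $Z$, it is $\min_{S\subseteq V,|S|\le k}\bigl(\sum_{i\in S}R^2_{Z,\{X_i\}}\bigr)/R^2_{Z,S}$, with the convention $0/0=1$; with several targets, $\gamma_{\emptyset,k}$ denotes the minimum of this quantity over $Z\in\{Z_1,\dots,Z_s\}$. Sparse eigenvalues: $\lambda_{\min}(C,k)=\min_{|S|=k}\lambda_{\min}(C_S)$ and $\lambda_{\max}(C,k)=\max_{|S|=k}\lambda_{\max}(C_S)$, where $\lambda_{\min}(\cdot),\lambda_{\max}(\cdot)$ of a matrix are its smallest and largest eigenvalues. *)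

(* Defs.v *)
From mathcomp Require Import all_boot all_order all_algebra.
From mathcomp Require Import all_classical all_reals all_analysis.

Set Implicit Arguments.
Unset Strict Implicit.
Unset Printing Implicit Defensive.

Import Order.TTheory GRing.Theory Num.Theory.

Local Open Scope classical_set_scope.
Local Open Scope ring_scope.

(* All [sup]/[inf] below except the one in [sq_mult_corr] range over finite
   sets of reals, so they are maxima/minima whenever the set is nonempty. *)

Definition cov_mx (d : measure_display) (T : measurableType d) (R : realType)
    (P : probability T R) (n : nat) (X : 'I_n -> {RV P >-> R}) : 'M[R]_n :=
  \matrix_(i, j) fine (covariance P (X i) (X j)).

(* The principal submatrix with rows and columns in S. *)
Definition submx_on (R : realType) (n : nat) (C : 'M[R]_n) (S : {set 'I_n}) :
    'M[R]_#|S| :=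
  mxsub (@enum_val _ (mem S)) (@enum_val _ (mem S)) C.

Definition lambda_min (R : realType) (m : nat) (A : 'M[R]_m) : R :=
  inf [set a : R | eigenvalue A a].

Definition lambda_max (R : realType) (m : nat) (A : 'M[R]_m) : R :=
  sup [set a : R | eigenvalue A a].

Definition sparse_lambda_min (R : realType) (n : nat) (C : 'M[R]_n) (k : nat) :
    R :=
  inf [set lambda_min (submx_on C S) | S in [set S : {set 'I_n} | #|S| = k]].

Definition sparse_lambda_max (R : realType) (n : nat) (C : 'M[R]_n) (k : nat) :
    R :=
  sup [set lambda_max (submx_on C S) | S in [set S : {set 'I_n} | #|S| = k]].

Definition mean_sq_err (d : measure_display) (T : measurableType d)
    (R : realType) (P : probability T R) (n : nat) (X : 'I_n -> {RV P >-> R})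
    (Z : {RV P >-> R}) (S : {set 'I_n}) (alpha : 'I_n -> R) : R :=
  fine (expectation P (fun w => (Z w - \sum_(i in S) alpha i * X i w) ^+ 2)).

(* The infimum is attained: it is a least-squares problem. *)
Definition sq_mult_corr (d : measure_display) (T : measurableType d)
    (R : realType) (P : probability T R) (n : nat) (X : 'I_n -> {RV P >-> R})
    (Z : {RV P >-> R}) (S : {set 'I_n}) : R :=
  1 - inf (range (mean_sq_err X Z S)).

(* The sets S over which the maxima defining F(D) and its modular
   approximation are taken. *)
Definition candidates (n k : nat) (D : {set 'I_n}) : set {set 'I_n} :=
  [set S | S \subset D /\ (if (#|D| < k)%N then (#|S| <= k)%N else #|S| == k)].

Definition dict_obj (d : measure_display) (T : measurableType d)
    (R : realType) (P : probability T R) (n s : nat)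
    (X : 'I_n -> {RV P >-> R}) (Z : 'I_s -> {RV P >-> R}) (k : nat)
    (D : {set 'I_n}) : R :=
  \sum_(j < s) sup [set sq_mult_corr X (Z j) S | S in candidates k D].

Definition dict_obj_modular (d : measure_display) (T : measurableType d)
    (R : realType) (P : probability T R) (n s : nat)
    (X : 'I_n -> {RV P >-> R}) (Z : 'I_s -> {RV P >-> R}) (k : nat)
    (D : {set 'I_n}) : R :=
  \sum_(j < s)
    sup [set \sum_(i in S) sq_mult_corr X (Z j) [set i]%SET
        | S in candidates k D].

(* [greedy_run f i D]: D is a possible value of the i-th iterate of the greedy
   algorithm maximizing f, ties being broken arbitrarily. *)
Inductive greedy_run (R : realType) (n : nat) (f : {set 'I_n} -> R) :
    nat -> {set 'I_n} -> Prop :=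
  | greedy_run0 : greedy_run f 0 finset.set0
  | greedy_runS (i : nat) (D : {set 'I_n}) (m : 'I_n) :
      greedy_run f i D ->
      m \notin D ->
      (forall m' : 'I_n, m' \notin D -> f (m' |: D)%SET <= f (m |: D)%SET) ->
      greedy_run f i.+1 (m |: D)%SET.

Definition SDS_MA_output (d : measure_display) (T : measurableType d)
    (R : realType) (P : probability T R) (n s : nat)
    (X : 'I_n -> {RV P >-> R}) (Z : 'I_s -> {RV P >-> R}) (k dsize : nat)
    (D : {set 'I_n}) : Prop :=
  greedy_run (dict_obj_modular X Z k) dsize D.

Definition optimal_dict (d : measure_display) (T : measurableType d)
    (R : realType) (P : probability T R) (n s : nat)
    (X : 'I_n -> {RV P >-> R}) (Z : 'I_s -> {RV P >-> R}) (k dsize : nat)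
    (D : {set 'I_n}) : Prop :=
  (#|D| <= dsize)%N /\
  forall D' : {set 'I_n}, (#|D'| <= dsize)%N ->
    dict_obj X Z k D' <= dict_obj X Z k D.

Definition quot00 (R : realType) (a b : R) : R :=
  if (a == 0) && (b == 0) then 1 else a / b.

Definition submod_ratio (d : measure_display) (T : measurableType d)
    (R : realType) (P : probability T R) (n : nat) (X : 'I_n -> {RV P >-> R})
    (Z : {RV P >-> R}) (k : nat) : R :=
  inf [set quot00 (\sum_(i in S) sq_mult_corr X Z [set i]%SET)
                 (sq_mult_corr X Z S)
      | S in [set S : {set 'I_n} | (#|S| <= k)%N]].

Definition submod_ratio_multi (d : measure_display) (T : measurableType d)
    (R : realType) (P : probability T R) (n s : nat)
    (X : 'I_n -> {RV P >-> R}) (Z : 'I_s -> {RV P >-> R}) (k : nat) : R :=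
  inf (range (fun j : 'I_s => submod_ratio X (Z j) k)).

(* Main.v *)
(* Against F, the modular objective costs only spectral factors: with
   b_i = Cov(Z, X_i), completing the square in the least-squares problem gives
   (sum_S b_i^2) / lmax <= R^2_S <= (sum_S b_i^2) / lmin for |S| <= k, where
   R^2_{i} = b_i^2.  Hence Fhat / lmax <= F, gamma F <= Fhat and lmin <= gamma.

   Fhat itself is a sum of "k largest weights in D" functions.  By linear
   programming duality such a function is the minimum over t >= 0 of
   k t + sum_{i in D} (w_i - t)^+, attained at the k-th largest weight of D;
   this yields submodularity, and thus the factor 1 - 1/e for greedy.

   The spectral theorem is not used: the Rayleigh bounds come from showing that
   the least mu with mu - A positive semidefinite is an eigenvalue of A. *)
Require Import Defs.
From mathcomp Require Import all_boot all_order all_algebra.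
From mathcomp Require Import all_classical all_reals all_analysis.
From mathcomp Require Import lra.

Set Implicit Arguments.
Unset Strict Implicit.
Unset Printing Implicit Defensive.

Import Order.TTheory GRing.Theory Num.Theory.

Local Open Scope classical_set_scope.
Local Open Scope ring_scope.

(** * Maxima over finite families and subsets of prescribed size *)

Lemma sup_finite (R : realType) (I : finType) (Q : set I) (f : I -> R) :
  Q !=set0 ->
  exists i, [/\ Q i, sup (f @` Q) = f i & forall j, Q j -> f j <= f i].
Proof.
move=> [i0 Qi0].
have Qi0' : i0 \in [pred i | `[< Q i >]] by apply/asboolP.
case: (arg_maxP f Qi0') => i /asboolP Qi max_i.
have le_i j : Q j -> f j <= f i by move=> Qj; apply: max_i; apply/asboolP.
have ub_i : ubound (f @` Q) (f i) by move=> _ [j Qj <-]; exact: le_i.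
exists i; split=> //; apply/le_anti/andP; split.
  by apply: ge_sup => //; exists (f i), i.
by apply: ub_le_sup; [exists (f i) | exists i].
Qed.

Lemma inf_finite (R : realType) (I : finType) (Q : set I) (f : I -> R) :
  Q !=set0 ->
  exists i, [/\ Q i, inf (f @` Q) = f i & forall j, Q j -> f i <= f j].
Proof.
move=> /(@sup_finite R I Q (fun i => - f i))[i [Qi sup_i max_i]].
exists i; split=> //; last by move=> j /max_i; rewrite lerN2.
by rewrite /inf image_comp sup_i opprK.
Qed.

Lemma exists_subset_card (T : finType) (A : {set T}) (k : nat) :
  (k <= #|A|)%N -> exists2 B : {set T}, B \subset A & #|B| = k.
Proof.
move=> le_kA; exists [set:: take k (enum A)]%SET.
  by apply/fintype.subsetP => x; rewrite inE => /mem_take; rewrite mem_enum.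
rewrite cardsE (card_uniqP _) ?take_uniq ?enum_uniq// size_take -cardE.
by case: ltngtP le_kA.
Qed.

Lemma exists_superset_card (T : finType) (A : {set T}) (k : nat) :
  (#|A| <= k <= #|T|)%N -> exists2 B : {set T}, A \subset B & #|B| = k.
Proof.
move=> /andP[le_Ak le_kT].
(* [B] collects the elements that the superset leaves out. *)
have [|B sBA cB] := @exists_subset_card _ (~: A) (#|T| - k).
  by rewrite -(cardsC A) leq_subLR leq_add2r.
exists (~: B); first by rewrite -finset.setCS finset.setCK.
by rewrite [#|_|](cardsCs) finset.setCK cB subKn.
Qed.

Lemma candidates_neq0 (n k : nat) (D : {set 'I_n}) : candidates k D !=set0.
Proof.
rewrite /candidates; case: ltnP => [_|le_kD].
  by exists finset.set0; rewrite /= finset.sub0set cards0.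
by have [S sSD <-] := exists_subset_card le_kD; exists S.
Qed.

Lemma candidates_card (n k : nat) (D S : {set 'I_n}) :
  candidates k D S -> S \subset D /\ (#|S| <= k)%N.
Proof. by rewrite /candidates /=; case: ifP => _ [? ]// /eqP->. Qed.

(** * The modular objective of a single target, with arbitrary weights *)

Definition modular_max (R : realType) (n k : nat) (w : 'I_n -> R)
    (D : {set 'I_n}) : R :=
  sup [set \sum_(i in S) w i | S in candidates k D].

Section ModularMax.
Context (R : realType) (n k : nat) (w : 'I_n -> R).
Hypothesis w_ge0 : forall i, 0 <= w i.
Local Notation F := (modular_max k w).

Lemma ler_sum_subset (A B : {set 'I_n}) (u : 'I_n -> R) :
  (forall i, 0 <= u i) -> A \subset B -> \sum_(i in A) u i <= \sum_(i in B) u i.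
Proof.
move=> u_ge0 sAB; rewrite (big_setID A (A := B)) /= (finset.setIidPr sAB).
by rewrite lerDl sumr_ge0.
Qed.

(** When [D] has at least [k] elements, candidates have exactly [k] of them. Since weights are
    nonnegative, a smaller [S] can be padded inside [D] without losing weight. *)
Lemma modular_max_ge (D S : {set 'I_n}) :
  S \subset D -> (#|S| <= k)%N -> \sum_(i in S) w i <= F D.
Proof.
move=> sSD le_Sk.
rewrite /modular_max; have [B0 [_ -> max_F]] :=
  sup_finite (fun S : {set 'I_n} => \sum_(i in S) w i) (candidates_neq0 k D).
case: (ltnP #|D| k) => [lt_Dk|le_kD].
  by apply: max_F; rewrite /candidates /= lt_Dk.
have [B sSB cB] : exists2 B : {set 'I_n}, S \subset B & B \subset D /\ #|B| = k.
  have [|E sED cE] := @exists_subset_card _ (D :\: S) (k - #|S|).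
    by rewrite cardsD (finset.setIidPr sSD) leq_sub2r.
  exists (S :|: E); first exact: finset.subsetUl.
  split; first by rewrite finset.subUset sSD (fintype.subset_trans sED) ?subsetDl.
  rewrite cardsU disjoint_setI0 ?cards0 ?subn0 ?cE ?subnKC//.
  rewrite disjoint_sym; apply: (disjointWl sED).
  rewrite -setI_eq0 finset.setDE -finset.setIA.
  by rewrite [~: S :&: S]finset.setIC finset.setICr finset.setI0.
case: cB => sBD cB; apply: le_trans (ler_sum_subset w_ge0 sSB) _.
by apply: max_F; rewrite /candidates /= ltnNge le_kD cB eqxx.
Qed.

(** Weak duality: sum [w i <= t + (w i - t)^+] over a maximizer. It has at most [k] elements, and
    [t >= 0] allows charging [k] times [t]. *)
Lemma modular_max_le_threshold (D : {set 'I_n}) (t : R) : 0 <= t ->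
  F D <= k%:R * t + \sum_(i in D) Num.max (w i - t) 0.
Proof.
move=> t_ge0.
rewrite /modular_max; have [S [/candidates_card[sSD cS] -> _]] :=
  sup_finite (fun S : {set 'I_n} => \sum_(i in S) w i) (candidates_neq0 k D).
apply: (@le_trans _ _ (\sum_(i in S) (t + Num.max (w i - t) 0))).
  by apply: ler_sum => i _; rewrite -lerBlDl le_max lexx.
rewrite big_split /= sumr_const lerD ?ler_sum_subset//.
  by rewrite -[t *+ _]mulr_natl ler_wpM2r// ler_nat.
by move=> i; rewrite le_max lexx orbT.
Qed.

(* [t] is the weight at rank [k] in [D], and [0] when [D] has fewer than [k]
   elements. *)
Lemma modular_max_threshold (D : {set 'I_n}) : (0 < k)%N -> exists t : R,
  [/\ 0 <= t,
      F D = k%:R * t + \sum_(i in D) Num.max (w i - t) 0 &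
      forall m, m \notin D -> F D + Num.max (w m - t) 0 <= F (m |: D)].
Proof.
move=> k_gt0.
have [B [candB defF maxB]] :=
  sup_finite (fun S : {set 'I_n} => \sum_(i in S) w i) (candidates_neq0 k D).
have [sBD cB] := candidates_card candB.
rewrite -/(F D) in defF.
case: (ltnP #|D| k) => [lt_Dk|le_kD].
  have FD : F D = \sum_(i in D) w i.
    apply/le_anti; rewrite modular_max_ge ?(ltnW lt_Dk)// andbT defF.
    exact: ler_sum_subset.
  exists 0; split=> //.
    by rewrite mulr0 add0r FD; apply: eq_bigr => i _; rewrite subr0 max_l.
  move=> m mD; rewrite FD subr0 max_l// addrC -big_setU1//=.
  by rewrite modular_max_ge// cardsU1 mD.
have {}cB : #|B| = k.
  by case: candB => _; rewrite ltnNge le_kD /= => /eqP.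
have [b0 b0B] : exists b, b \in B by apply/set0Pn; rewrite -card_gt0 cB.
(* A lightest element [b] of the maximizer [B] sets the threshold; exchanges against [b] yield the
   remaining claims. *)
case: (arg_minP w b0B) => b; rewrite -[X in is_true X]/(b \in B) => bB min_b.
have swap m : m \notin B -> \sum_(i in m |: B :\ b) w i = F D + (w m - w b).
  move=> mB; rewrite big_setU1 /= ?inE ?negb_and ?mB ?orbT//.
  by rewrite defF [X in _ = X + _](big_setD1 b)//=; lra.
have card_swap m : m \notin B -> #|m |: B :\ b| = k.
  by move=> mB; rewrite cardsU1 !inE negb_and mB orbT -cB (cardsD1 b B) bB.
exists (w b); split=> //.
  rewrite (big_setID B) /= (finset.setIidPr sBD) [X in _ + (_ + X)]big1 => [|i].
    rewrite addr0 defF mulr_natl -cB -sumr_const -big_split /=.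
    by apply: eq_bigr => i iB; rewrite max_l ?subr_ge0 ?min_b// addrC subrK.
  (* If [i] in [D] outside [B] weighed more than [b], exchanging them would beat the maximum; hence
     its positive part is 0. *)
  rewrite inE => /andP[iB iD]; apply: max_r.
  have : \sum_(j in i |: B :\ b) w j <= F D.
    apply: modular_max_ge; last by rewrite card_swap.
    by rewrite finset.subUset finset.sub1set iD (fintype.subset_trans (subD1set _ _)).
  by rewrite swap// gerDl.
(* Exchanging [b] for [m] gains [w m - w b], keeping [B] gains 0; the claimed gain is the larger of
   the two. *)
move=> m mD; have mB : m \notin B by apply: contra mD; apply/fintype.subsetP.
rewrite -[Num.max _ _]addr0 addrA addr0 -lerBrDl ge_max !lerBrDl -swap// addr0.
apply/andP; split.
  apply: modular_max_ge; last by rewrite card_swap.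
  by rewrite finset.setUS// (fintype.subset_trans (subD1set _ _)).
by rewrite defF modular_max_ge ?cB// (fintype.subset_trans sBD) ?finset.subsetUr.
Qed.

Lemma modular_max_mono (D : {set 'I_n}) (m : 'I_n) : (0 < k)%N -> F D <= F (m |: D).
Proof.
move=> k_gt0; case: (boolP (m \in D)) => [mD|mD].
  by rewrite (finset.setUidPr _) ?finset.sub1set.
have [t [_ _ /(_ m mD)]] := modular_max_threshold D k_gt0.
by apply: le_trans; rewrite lerDl le_max lexx orbT.
Qed.

(** The threshold [t] of [D] serves both sets: the dual bound at [t] is exact for [D] and an upper
    bound for [D']. The two differ by at most the sum of [(w m - t)^+] over [D' :\: D], and each
    term is at most a marginal gain. This is submodularity in the form that greedy needs. *)
Lemma modular_max_gain (D D' : {set 'I_n}) : (0 < k)%N ->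
  F D' - F D <= \sum_(m in D' :\: D) (F (m |: D) - F D).
Proof.
move=> k_gt0; have [t [t_ge0 FD gain]] := modular_max_threshold D k_gt0.
rewrite lerBlDl; apply: le_trans (modular_max_le_threshold D' t_ge0) _.
rewrite {1}FD -addrA lerD2l (big_setID D) /= lerD//.
  by apply: ler_sum_subset; rewrite ?subsetIr// => i; rewrite le_max lexx orbT.
by apply: ler_sum => m; rewrite inE => /andP[mD _]; rewrite lerBrDl gain.
Qed.

End ModularMax.

(** * Greedy maximization of a monotone set function with the submodular gain inequality *)

Section Greedy.
Context (R : realType) (n : nat) (f : {set 'I_n} -> R).
Hypothesis f_mono : forall D m, f D <= f (m |: D)%SET.
Hypothesis f_gain : forall D D',
  f D' - f D <= \sum_(m in D' :\: D) (f (m |: D)%SET - f D).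

(** The gains of the elements of [D' :\: D] add up to at least the gap, and there are at most [d] of
    them. So the greedy element, which gains the most, closes at least a fraction 1/d of the gap. *)
Lemma greedy_gap (d i : nat) (D D' : {set 'I_n}) : (0 < d)%N -> (#|D'| <= d)%N ->
  greedy_run f i D ->
  f D' - f D <= (1 - d%:R^-1) ^+ i * (f D' - f finset.set0).
Proof.
move=> d_gt0 cD'; have d0 : 0 < d%:R :> R by rewrite ltr0n.
have dV : d%:R^-1 <= 1 :> R by rewrite invf_le1// ler1n.
elim=> [|{}i {}D m _ IH mD max_m]; first by rewrite expr0 mul1r.
have le_dgain : f D' - f D <= d%:R * (f (m |: D)%SET - f D).
  apply: le_trans (f_gain _ _) _.
  apply: (@le_trans _ _ (\sum_(m' in D' :\: D) (f (m |: D)%SET - f D))).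
    by apply: ler_sum => m'; rewrite inE => /andP[m'D _]; rewrite lerB// max_m.
  (* Monotonicity makes the gain nonnegative, so the number of terms may be raised to [d]. *)
  rewrite sumr_const -[_ *+ #|_|]mulr_natl ler_wpM2r ?subr_ge0// ler_nat.
  exact: leq_trans (subset_leq_card (subsetDl _ _)) cD'.
rewrite exprS -mulrA.
apply: (@le_trans _ _ ((1 - d%:R^-1) * (f D' - f D))); last first.
  by rewrite ler_wpM2l// subr_ge0.
have : d%:R^-1 * (f D' - f D) <= f (m |: D)%SET - f D.
  by rewrite -(ler_pM2l d0) mulrA mulfV ?mul1r ?gt_eqF.
lra.
Qed.

Lemma greedy_approx (d : nat) (D D' : {set 'I_n}) : (0 < d)%N -> (#|D'| <= d)%N ->
  0 <= f finset.set0 -> f finset.set0 <= f D' -> greedy_run f d D ->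
  (1 - 1 / expR 1) * f D' <= f D.
Proof.
move=> d_gt0 cD' f0 f0D' /(greedy_gap d_gt0 cD') gap.
have d0 : 0 < d%:R :> R by rewrite ltr0n.
have dV : d%:R^-1 <= 1 :> R by rewrite invf_le1// ler1n.
(* Raise [1 + x <= expR x] at [x = - 1/d] to the power [d]. *)
have pow_le : (1 - d%:R^-1) ^+ d <= 1 / expR 1 :> R.
  rewrite div1r -expRN.
  have -> : -1 = (- d%:R^-1) * d%:R :> R by rewrite mulNr mulVf// gt_eqF.
  rewrite mulrC expRM_natl lerXn2r ?nnegrE ?subr_ge0 ?expR_ge0//.
  exact: expR_ge1Dx.
have e0 : 0 <= 1 / expR 1 :> R by rewrite div1r invr_ge0 expR_ge0.
(* The power is replaced by 1/e, and then the nonnegative term [f finset.set0] is discarded. *)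
have := ler_wpM2r (_ : 0 <= f D' - f finset.set0) pow_le.
rewrite subr_ge0 => /(_ f0D').
have := mulr_ge0 e0 f0.
nra.
Qed.

End Greedy.

(** * Extreme eigenvalues of symmetric matrices as Rayleigh bounds *)

Section Rayleigh.
Context (R : realType).

Lemma sqnorm_ge0 (m : nat) (x : 'rV[R]_m) : 0 <= (x *m x^T) 0 0.
Proof. by rewrite mxE sumr_ge0// => i _; rewrite mxE -expr2 sqr_ge0. Qed.

Lemma sqnorm_eq0 (m : nat) (x : 'rV[R]_m) : (x *m x^T) 0 0 = 0 -> x = 0.
Proof.
rewrite mxE => /eqP; rewrite psumr_eq0 => [/allP x0|i _]; last first.
  by rewrite mxE -expr2 sqr_ge0.
apply/rowP => i; have := x0 i (mem_index_enum i).
by rewrite !mxE /= -expr2 sqrf_eq0 => /eqP.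
Qed.

Lemma qform_ub (m : nat) (A : 'M[R]_m) : exists2 K : R, 0 < K &
  forall x : 'rV_m, (x *m A *m x^T) 0 0 <= K * (x *m x^T) 0 0.
Proof.
(* Each [|x_i x_j|] is at most the squared norm, whence the sum of absolute entries; the extra 1
   makes the constant invertible. *)
exists (1 + \sum_i \sum_j `|A j i|) => [|x].
  by rewrite ltr_pwDl// sumr_ge0// => i _; rewrite sumr_ge0.
have sq_le i : x 0 i ^+ 2 <= (x *m x^T) 0 0.
  rewrite mxE (bigD1 i)//= mxE -expr2 lerDl sumr_ge0// => j _.
  by rewrite mxE -expr2 sqr_ge0.
apply: (@le_trans _ _ ((\sum_i \sum_j `|A j i|) * (x *m x^T) 0 0)); last first.
  by rewrite ler_wpM2r ?sqnorm_ge0// lerDr.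
rewrite [in leLHS]mxE mulr_suml; apply: ler_sum => i _.
rewrite !mxE !mulr_suml; apply: ler_sum => j _.
apply: le_trans (ler_norm _) _; rewrite !normrM mulrAC [_ * `|A j i|]mulrC.
apply: ler_wpM2l => //; have := sq_le i; have := sq_le j; rewrite mxE.
rewrite -(real_normK (num_real (x 0 i))) -(real_normK (num_real (x 0 j))).
by have := sqr_ge0 (`|x 0 i| - `|x 0 j|); lra.
Qed.

(** Quantitative positive definiteness without diagonalization: the constant is the reciprocal of a
    bound on the form of the inverse. *)
Lemma psd_unit_coercive (m : nat) (B : 'M[R]_m) : B^T = B ->
  (forall x : 'rV_m, 0 <= (x *m B *m x^T) 0 0) -> B \in unitmx ->
  exists2 c : R, 0 < c & forall x : 'rV_m, c * (x *m x^T) 0 0 <= (x *m B *m x^T) 0 0.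
Proof.
move=> symB psdB uB; have [K K_gt0 ubK] := qform_ub (invmx B)^T.
exists K^-1 => [|x]; first by rewrite invr_gt0.
(* Expand [0 <= q(x - K^-1 y)] at [y = x B^-1], where [q] is the form of [B]:
   both the cross term and [q(y)] are controlled by [|x|^2]. *)
pose y := x *m invmx B.
have := psdB (x - K^-1 *: y).
have -> : (x - K^-1 *: y)^T = x^T - K^-1 *: y^T by rewrite linearB linearZ.
rewrite !(mulmxBl, mulmxBr) -!scalemxAl -!scalemxAr.
have -> : y *m B = x by rewrite /y -mulmxA mulVmx// mulmx1.
have -> : x *m B *m y^T = x *m x^T.
  by rewrite /y trmx_mul trmx_inv symB !mulmxA -[x *m B *m _]mulmxA mulmxV// mulmx1.
have := ubK x; rewrite -mulmxA -trmx_mul -/y.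
set p := x *m y^T; set q := x *m x^T; set r := x *m B *m x^T.
move: p q r => p q r; rewrite !mxE => le_p.
have KV : K^-1 * K = 1 by rewrite mulVf// gt_eqF.
have := ler_wpM2l (_ : 0 <= K^-1) le_p; rewrite invr_ge0 ltW// mulrA KV mul1r.
move=> /(_ isT) le_p'; have := ler_wpM2l (_ : 0 <= K^-1) le_p'.
rewrite invr_ge0 ltW// => /(_ isT); lra.
Qed.

(* The least [mu] for which [mu - A] is positive semidefinite is an eigenvalue:
   otherwise [mu - A] would be coercive and [mu] could be decreased. *)
Lemma exists_max_eigenvalue (m : nat) (A : 'M[R]_m) : (0 < m)%N -> A^T = A ->
  exists2 a : R, eigenvalue A a &
    forall x : 'rV_m, (x *m A *m x^T) 0 0 <= a * (x *m x^T) 0 0.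
Proof.
move=> m_gt0 symA.
pose M := [set mu : R | forall x : 'rV_m,
  (x *m A *m x^T) 0 0 <= mu * (x *m x^T) 0 0].
have M_lb (x : 'rV_m) : x != 0 -> forall mu, M mu ->
    (x *m A *m x^T) 0 0 / (x *m x^T) 0 0 <= mu.
  move=> x0 mu Mmu; rewrite ler_pdivrMr// lt_def sqnorm_ge0 andbT.
  by apply: contra x0 => /eqP /sqnorm_eq0 ->.
have M0 : M !=set0 by have [K _ ubK] := qform_ub A; exists K.
have lbM : has_lbound M.
  (* As [m] is positive there is a nonzero vector, and its Rayleigh quotient bounds [M] from
     below. *)
  pose x : 'rV[R]_m := delta_mx 0 (Ordinal m_gt0).
  have x0 : x != 0.
    apply/eqP => /rowP/(_ (Ordinal m_gt0)); rewrite !mxE !eqxx => /eqP.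
    by rewrite oner_eq0.
  by eexists => mu Mmu; exact: (M_lb x x0).
(* For each nonzero [x], the condition in [M] says that [mu] is at least the Rayleigh quotient of
   [x], so it passes to the infimum. *)
have Minf : M (inf M).
  move=> x; have [->|x0] := eqVneq x 0; first by rewrite !mul0mx mxE mulr0.
  rewrite -ler_pdivrMr; first exact: lb_le_inf (M_lb x x0).
  rewrite lt_def sqnorm_ge0 andbT.
  by apply: contra x0 => /eqP /sqnorm_eq0 ->.
exists (inf M) => //; rewrite /eigenvalue /eigenspace kermx_eq0 row_free_unit.
apply/negP => uA.
have qB (a : R) (x : 'rV_m) : (x *m (a%:M - A) *m x^T) 0 0 =
    a * (x *m x^T) 0 0 - (x *m A *m x^T) 0 0.
  by rewrite mulmxBr mulmxBl mul_mx_scalar -scalemxAl !mxE.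
have [||| c c_gt0 lec] := @psd_unit_coercive m ((inf M)%:M - A).
- by rewrite linearB /= tr_scalar_mx symA.
- by move=> x; rewrite qB subr_ge0 Minf.
- by rewrite -opprB -scaleN1r unitmxZ ?unitrN1.
have : M (inf M - c).
  by move=> x; have := lec x; rewrite qB; lra.
by move/(ge_inf lbM); lra.
Qed.

Lemma eigenvalue_le (m : nat) (A : 'M[R]_m) (a b : R) : eigenvalue A b ->
  (forall x : 'rV_m, (x *m A *m x^T) 0 0 <= a * (x *m x^T) 0 0) -> b <= a.
Proof.
move=> /eigenvalueP[v vA v0] /(_ v); rewrite vA -scalemxAl mxE ler_pM2r//.
rewrite lt_def sqnorm_ge0 andbT.
by apply: contra v0 => /eqP /sqnorm_eq0 ->.
Qed.

(** The eigenvalue from [exists_max_eigenvalue] dominates the form, hence, by testing on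
    eigenvectors, every other eigenvalue. So the supremum is attained there. *)
Lemma lambda_max_rayleigh (m : nat) (A : 'M[R]_m) : (0 < m)%N -> A^T = A ->
  eigenvalue A (lambda_max A) /\
  forall x : 'rV_m, (x *m A *m x^T) 0 0 <= lambda_max A * (x *m x^T) 0 0.
Proof.
move=> m_gt0 symA; have [a eig_a max_a] := exists_max_eigenvalue m_gt0 symA.
suff -> : lambda_max A = a by [].
have ub_a : ubound [set b | eigenvalue A b] a.
  by move=> b eig_b; exact: eigenvalue_le max_a.
apply/le_anti/andP; split; first by apply: ge_sup => //; exists a.
by apply: ub_le_sup => //; exists a.
Qed.

Lemma eigenvalueN (m : nat) (A : 'M[R]_m) (a : R) :
  eigenvalue (- A) a = eigenvalue A (- a).
Proof.
by apply/eigenvalueP/eigenvalueP => -[v vA v0]; exists v => //;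
  [rewrite scaleNr -vA mulmxN opprK | rewrite mulmxN vA scaleNr opprK].
Qed.

Lemma lambda_minE (m : nat) (A : 'M[R]_m) : lambda_min A = - lambda_max (- A).
Proof.
rewrite /lambda_min /inf /lambda_max; congr (- sup _).
apply/seteqP; split=> a /=; first by move=> [b eig_b <-]; rewrite eigenvalueN opprK.
by rewrite eigenvalueN => eig_a; exists (- a); rewrite ?opprK.
Qed.

Lemma lambda_min_rayleigh (m : nat) (A : 'M[R]_m) : (0 < m)%N -> A^T = A ->
  eigenvalue A (lambda_min A) /\
  forall x : 'rV_m, lambda_min A * (x *m x^T) 0 0 <= (x *m A *m x^T) 0 0.
Proof.
move=> m_gt0 symA; have [|eig max] := @lambda_max_rayleigh m (- A) m_gt0.
  by rewrite linearN /= symA.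
split=> [|x]; first by rewrite lambda_minE -eigenvalueN.
rewrite lambda_minE mulNr lerNl; have := max x.
by rewrite mulmxN mulNmx mxE.
Qed.

End Rayleigh.

(** * Quadratic forms of principal submatrices and sparse eigenvalues *)

Definition qform (R : realType) (n : nat) (C : 'M[R]_n) (S : {set 'I_n})
    (v : 'I_n -> R) : R :=
  \sum_(i in S) \sum_(j in S) v i * v j * C i j.

Section SparseEigenvalues.
Context (R : realType) (n : nat) (C : 'M[R]_n).
Hypothesis symC : forall i j, C i j = C j i.

(** Translates row vectors over the enumeration of [S] into functions on ['I_n], which allow
    different sets [S] to be compared without reindexing. *)
Lemma qform_submx_on (S : {set 'I_n}) (v : 'I_n -> R) :
  let x := \row_i v (enum_val i) : 'rV_#|S| in
  (x *m submx_on C S *m x^T) 0 0 = qform C S v /\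
  (x *m x^T) 0 0 = \sum_(i in S) v i ^+ 2.
Proof.
move=> x; split; last first.
  by rewrite mxE [RHS]big_enum_val; apply: eq_bigr => i _; rewrite !mxE expr2.
rewrite /qform exchange_big mxE [RHS]big_enum_val; apply: eq_bigr => j _.
rewrite !mxE mulr_suml [RHS]big_enum_val; apply: eq_bigr => i _.
by rewrite !mxE; lra.
Qed.

Lemma submx_on_sym (S : {set 'I_n}) : (submx_on C S)^T = submx_on C S.
Proof. by apply/matrixP => i j; rewrite !mxE symC. Qed.

Lemma qform_le_lambda_max (S : {set 'I_n}) (v : 'I_n -> R) : (0 < #|S|)%N ->
  qform C S v <= lambda_max (submx_on C S) * \sum_(i in S) v i ^+ 2.
Proof.
move=> S0; have [<- <-] := qform_submx_on S v.
by have [_] := lambda_max_rayleigh S0 (submx_on_sym S); apply.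
Qed.

Lemma qform_ge_lambda_min (S : {set 'I_n}) (v : 'I_n -> R) : (0 < #|S|)%N ->
  lambda_min (submx_on C S) * \sum_(i in S) v i ^+ 2 <= qform C S v.
Proof.
move=> S0; have [<- <-] := qform_submx_on S v.
by have [_] := lambda_min_rayleigh S0 (submx_on_sym S); apply.
Qed.

(** Padding by zeros transfers bounds from a larger principal submatrix to a smaller one. *)
Lemma qform_extend (S S' : {set 'I_n}) (v : 'I_n -> R) : S \subset S' ->
  let v' i := if i \in S then v i else 0 in
  qform C S' v' = qform C S v /\
  \sum_(i in S') v' i ^+ 2 = \sum_(i in S) v i ^+ 2.
Proof.
move=> sSS' v'.
have sum_supp (F G : 'I_n -> R) : (forall i, i \in S -> F i = G i) ->
    (forall i, i \notin S -> F i = 0) -> \sum_(i in S') F i = \sum_(i in S) G i.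
  move=> FG F0; rewrite (big_setID S) /= (finset.setIidPr sSS').
  rewrite [X in _ + X]big1 ?addr0 => [|i]; first exact: eq_bigr.
  by rewrite inE => /andP[iS _]; exact: F0.
split; apply: (@sum_supp) => i; rewrite /v'.
- move=> iS; rewrite iS.
  by apply: sum_supp => [j ->//|j /negPf->]; rewrite mulr0 mul0r.
- by move/negPf->; rewrite big1// => j _; rewrite !mul0r.
- by move->.
- by move/negPf->; rewrite expr0n.
Qed.

Context (k : nat).
Hypotheses (k_gt0 : (0 < k)%N) (le_kn : (k <= n)%N).

Let ksets_neq0 : [set S : {set 'I_n} | #|S| = k] !=set0.
Proof.
have [|S _ cS] := @exists_subset_card _ [set: 'I_n] k; last by exists S.
by rewrite cardsT card_ord.
Qed.

(** Sparse eigenvalues range over sets of size exactly [k]; a smaller [S] is first enlarged to size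
    [k], which [k <= n] permits. *)
Lemma qform_le_sparse (S : {set 'I_n}) (v : 'I_n -> R) : (#|S| <= k)%N ->
  qform C S v <= sparse_lambda_max C k * \sum_(i in S) v i ^+ 2.
Proof.
move=> cS; have [|S' sSS' cS'] := @exists_superset_card _ S k.
  by rewrite cS card_ord.
have [<- <-] := qform_extend v sSS'.
apply: le_trans (qform_le_lambda_max _ _) _; first by rewrite cS'.
rewrite ler_wpM2r ?sumr_ge0// => [i _|]; first exact: sqr_ge0.
rewrite /sparse_lambda_max; have [S0 [_ -> max_S0]] :=
  sup_finite (fun S : {set 'I_n} => lambda_max (submx_on C S)) ksets_neq0.
exact: max_S0.
Qed.

Lemma qform_ge_sparse (S : {set 'I_n}) (v : 'I_n -> R) : (#|S| <= k)%N ->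
  sparse_lambda_min C k * \sum_(i in S) v i ^+ 2 <= qform C S v.
Proof.
move=> cS; have [|S' sSS' cS'] := @exists_superset_card _ S k.
  by rewrite cS card_ord.
have [<- <-] := qform_extend v sSS'.
apply: le_trans (qform_ge_lambda_min _ _); last by rewrite cS'.
rewrite ler_wpM2r ?sumr_ge0// => [i _|]; first exact: sqr_ge0.
rewrite /sparse_lambda_min; have [S0 [_ -> min_S0]] :=
  inf_finite (fun S : {set 'I_n} => lambda_min (submx_on C S)) ksets_neq0.
exact: min_S0.
Qed.

Hypothesis C_psd : forall v, 0 <= qform C [set: 'I_n] v.
Hypothesis C_unit : C \in unitmx.

Lemma qformT (x : 'rV[R]_n) :
  qform C [set: 'I_n] (x 0) = (x *m C *m x^T) 0 0.
Proof.
rewrite /qform exchange_big mxE (eq_bigl predT) => [|i]; last by rewrite inE.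
apply: eq_bigr => j _; rewrite !mxE mulr_suml.
by rewrite (eq_bigl predT) => [|i]; [apply: eq_bigr => i _; lra | rewrite inE].
Qed.

(** The minimum is an eigenvalue of some [submx_on C S]. Its eigenvector, padded by zeros, is tested
    against the coercivity of the whole matrix [C]. *)
Lemma sparse_lambda_min_gt0 : 0 < sparse_lambda_min C k.
Proof.
rewrite /sparse_lambda_min; have [S [/= cS -> _]] :=
  inf_finite (fun S : {set 'I_n} => lambda_min (submx_on C S)) ksets_neq0.
have S0 : (0 < #|S|)%N by rewrite cS.
have [/eigenvalueP[x xA x0] _] := lambda_min_rayleigh S0 (submx_on_sym S).
have [||c c_gt0 coercive] := @psd_unit_coercive R n C _ _ C_unit.
- by apply/matrixP => i j; rewrite mxE symC.
- by move=> y; rewrite -qformT C_psd.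
have [i0 i0S] : exists i, i \in S by apply/set0Pn; rewrite -card_gt0.
(* Off [S] the rank is a default, so [v] is arbitrary there; the padding below overwrites those
   values. *)
pose v i := x 0 (enum_rank_in i0S i).
have xE : x = \row_i v (enum_val i).
  by apply/rowP => i; rewrite mxE /v enum_valK_in.
have [] := qform_submx_on S v; rewrite -xE => qE nE.
have n_gt0 : 0 < (x *m x^T) 0 0.
  rewrite lt_def sqnorm_ge0 andbT.
  by apply: contra x0 => /eqP /sqnorm_eq0 ->.
have [] := qform_extend v (finset.subsetT S) => qE' nE'.
have := coercive (\row_i (if i \in S then v i else 0)); rewrite -qformT.
set y := \row_i _.
have -> : qform C [set: 'I_n] (y 0) = qform C S v.
  by rewrite -qE' /qform; apply: eq_bigr => i _; apply: eq_bigr => j _; rewrite !mxE.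
have -> : (y *m y^T) 0 0 = (x *m x^T) 0 0.
  rewrite nE -nE' mxE [RHS](eq_bigl predT) => [|i]; last by rewrite inE.
  by apply: eq_bigr => i _; rewrite !mxE expr2.
(* On the eigenvector the form is the eigenvalue times the squared norm; cancelling the norm leaves
   [c] below the eigenvalue. *)
rewrite -qE xA -scalemxAl [in X in _ <= X -> _]mxE.
by rewrite ler_pM2r//; apply: lt_le_trans.
Qed.

Hypothesis C_diag : forall i, C i i = 1.

Let qform1 (i : 'I_n) (v : 'I_n -> R) :
  qform C [set i]%SET v = \sum_(j in [set i]%SET) v j ^+ 2.
Proof. by rewrite /qform !big_set1 C_diag; lra. Qed.

Let i0 : 'I_n := Ordinal (leq_trans k_gt0 le_kn).

(** A singleton has Rayleigh quotient 1 because the diagonal of [C] is 1; the same test bounds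
    [sparse_lambda_max] from below. *)
Lemma sparse_lambda_min_le1 : sparse_lambda_min C k <= 1.
Proof.
have := @qform_ge_sparse [set i0]%SET (fun=> 1); rewrite cards1 qform1 big_set1.
by move=> /(_ k_gt0); rewrite expr1n mulr1.
Qed.

Lemma sparse_lambda_max_ge1 : 1 <= sparse_lambda_max C k.
Proof.
have := @qform_le_sparse [set i0]%SET (fun=> 1); rewrite cards1 qform1 big_set1.
by move=> /(_ k_gt0); rewrite expr1n mulr1.
Qed.

End SparseEigenvalues.

(** * Bounds on the optimal value of a least-squares problem *)

Section LeastSquares.
Context (R : realType) (n : nat) (C : 'M[R]_n) (b : 'I_n -> R) (S : {set 'I_n}).

(** The expanded mean squared error for a target of variance 1 whose covariances with the regressors
    are [b]. *)
Definition lsq_err (alpha : 'I_n -> R) : R :=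
  1 - 2 * (\sum_(i in S) alpha i * b i) + qform C S alpha.

Lemma qformZ (c : R) (v : 'I_n -> R) :
  qform C S (fun i => c * v i) = c ^+ 2 * qform C S v.
Proof.
rewrite /qform mulr_sumr; apply: eq_bigr => i _.
by rewrite mulr_sumr; apply: eq_bigr => j _; rewrite expr2; lra.
Qed.

(** Test the coefficients [b / lam]: the quadratic term is at most half the linear one.
    Nonnegativity of the error makes the infimum genuine. *)
Lemma lsq_gain_ge (lam : R) : 0 < lam ->
  (forall alpha, 0 <= lsq_err alpha) ->
  (forall v, qform C S v <= lam * \sum_(i in S) v i ^+ 2) ->
  (\sum_(i in S) b i ^+ 2) / lam <= 1 - inf (range lsq_err).
Proof.
move=> lam_gt0 err_ge0 q_le; rewrite lerBrDr -lerBrDl.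
have lb : has_lbound (range lsq_err) by exists 0 => _ [alpha _ <-].
apply: (@le_trans _ _ (lsq_err (fun i => lam^-1 * b i))).
  by apply: ge_inf => //; exists (fun i => lam^-1 * b i).
rewrite /lsq_err qformZ.
have -> : \sum_(i in S) lam^-1 * b i * b i = lam^-1 * \sum_(i in S) b i ^+ 2.
  by rewrite mulr_sumr; apply: eq_bigr => i _; rewrite expr2 mulrA.
have := ler_wpM2l (sqr_ge0 lam^-1) (q_le b).
rewrite mulrA [X in _ <= X * _ -> _](_ : _ = lam^-1); first by lra.
by rewrite expr2 -mulrA mulVf ?mulr1// gt_eqF.
Qed.

(** After replacing the form by its diagonal lower bound, the square is completed separately in each
    coordinate. *)
Lemma lsq_gain_le (lam : R) : 0 < lam ->
  (forall v, lam * (\sum_(i in S) v i ^+ 2) <= qform C S v) ->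
  1 - inf (range lsq_err) <= (\sum_(i in S) b i ^+ 2) / lam.
Proof.
move=> lam_gt0 q_ge; rewrite lerBlDr -lerBlDl; apply: lb_le_inf.
  by exists (lsq_err (fun=> 0)), (fun=> 0).
move=> _ [alpha _ <-]; rewrite /lsq_err.
suff : 2 * (\sum_(i in S) alpha i * b i) <=
    lam * (\sum_(i in S) alpha i ^+ 2) + (\sum_(i in S) b i ^+ 2) / lam.
  by have := q_ge alpha; lra.
rewrite !mulr_sumr mulr_suml -big_split /=; apply: ler_sum => i _.
rewrite -subr_ge0.
have -> : lam * alpha i ^+ 2 + b i ^+ 2 / lam - 2 * (alpha i * b i) =
    lam * (alpha i - b i / lam) ^+ 2.
  have E : lam / lam = 1 by rewrite mulfV// gt_eqF.
  have -> : lam * (alpha i - b i / lam) ^+ 2 = lam * alpha i ^+ 2 +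
     (lam / lam) * (b i ^+ 2 / lam) - (lam / lam) * 2 * (alpha i * b i) by lra.
  by rewrite E; lra.
by rewrite mulr_ge0 ?sqr_ge0 ?ltW.
Qed.

End LeastSquares.

(** * Square integrability and expansion of the mean squared error *)

Section SecondMoments.
Context (disp : measure_display) (T : measurableType disp) (R : realType).
Context (P : probability T R).
Implicit Types X Y : T -> R.

Definition moment2 X Y : R := fine 'E_P[X \* Y].

(** With mean 0, the variance is the integral of the square, so its being finite is square
    integrability. *)
Lemma Lfun2_standardized (X : {RV P >-> R}) :
  ('E_P[X] = 0)%E -> ('V_P[X] = 1)%E -> (X : T -> R) \in Lfun P 2%:E.
Proof.
move=> EX; rewrite /variance unlock EX /= => VX.
rewrite inE; apply/andP; split; rewrite inE /=; first exact: measurable_funPT.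
rewrite /finite_norm unlock /= poweR_lty//.
rewrite unlock in VX; rewrite (_ : (\int[_]_ _ _)%E = 1%E) ?ltry//.
rewrite -[RHS]VX; apply: eq_integral => w _ /=.
rewrite -[RHS]/((X w - 0) * (X w - 0))%:E subr0 powR_mulrn//.
by rewrite real_normK ?num_real// expr2.
Qed.

Lemma covariance_centered X Y : ('E_P[X] = 0)%E -> ('E_P[Y] = 0)%E ->
  covariance P X Y = 'E_P[X \* Y]%E.
Proof.
move=> EX EY; rewrite unlock EX EY /=; congr ('E_P[_])%E.
by apply/funext => w; rewrite -[LHS]/((X w - 0) * (Y w - 0)) !subr0.
Qed.

(** Integrability is carried through the induction because the expectation is split only between
    integrable functions. *)
Lemma fine_expectation_sum (I : Type) (r : seq I) (Q : pred I) (F : I -> T -> R) :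
  (forall i, F i \in Lfun P 1) ->
  (\sum_(i <- r | Q i) F i) \in Lfun P 1 /\
  fine 'E_P[\sum_(i <- r | Q i) F i] = \sum_(i <- r | Q i) fine 'E_P[F i].
Proof.
move=> L1F; apply: (big_rec2 (fun g x => g \in Lfun P 1 /\ fine 'E_P[g] = x)).
  by split; [exact: Lfun_cst | rewrite expectation_cst].
move=> i x g _ [L1g <-]; split; first by rewrite rpredD.
by rewrite expectationD// fineD ?expectation_fin_num.
Qed.

Lemma mean_sq_err_expand (n : nat) (X : 'I_n -> T -> R) Y (S : {set 'I_n})
    (alpha : 'I_n -> R) :
  (forall i, X i \in Lfun P 2%:E) -> Y \in Lfun P 2%:E ->
  fine 'E_P[fun w => (Y w - \sum_(i in S) alpha i * X i w) ^+ 2] =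
  moment2 Y Y - 2 * (\sum_(i in S) alpha i * moment2 Y (X i)) +
    \sum_(i in S) \sum_(j in S) alpha i * alpha j * moment2 (X i) (X j).
Proof.
move=> L2X L2Y.
pose F i : T -> R := (-2 * alpha i) \o* (Y \* X i).
pose G i j : T -> R := (alpha i * alpha j) \o* (X i \* X j).
have L1F i : F i \in Lfun P 1 by rewrite Lfun_scale// Lfun2_mul_Lfun1.
have L1G i j : G i j \in Lfun P 1 by rewrite Lfun_scale// Lfun2_mul_Lfun1.
have -> : (fun w => (Y w - \sum_(i in S) alpha i * X i w) ^+ 2) =
    Y \* Y + \sum_(i in S) F i + \sum_(i in S) \sum_(j in S) G i j.
  apply/funext => w; rewrite /= !fctE !fct_sumE.
  under [X in _ = _ + X]eq_bigr do rewrite fct_sumE.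
  rewrite sqrrB [X in _ + X]expr2 big_distrlr /= expr2; congr (_ + _ + _).
    rewrite mulr_sumr -sumrMnl -sumrN; apply: eq_bigr => i _; rewrite /F /=; lra.
  by apply: eq_bigr => i _; apply: eq_bigr => j _; rewrite /G /=; lra.
have [L1SF ESF] := @fine_expectation_sum _ (index_enum 'I_n) (mem S) F L1F.
have L1GS i : \sum_(j in S) G i j \in Lfun P 1.
  by have [] := @fine_expectation_sum _ (index_enum 'I_n) (mem S) (G i) (L1G i).
have [L1SG ESG] := @fine_expectation_sum _ (index_enum 'I_n) (mem S) _ L1GS.
have L1YY : Y \* Y \in Lfun P 1 by rewrite Lfun2_mul_Lfun1.
rewrite expectationD ?rpredD// fineD ?expectation_fin_num ?rpredD//.
rewrite expectationD// fineD ?expectation_fin_num//.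
rewrite ESF ESG; congr (_ + _ + _).
  rewrite -mulNr mulr_sumr; apply: eq_bigr => i _.
  rewrite expectationZl ?Lfun2_mul_Lfun1// fineM ?expectation_fin_num ?Lfun2_mul_Lfun1//.
  by rewrite mulrA.
apply: eq_bigr => i _.
have [_ ->] := @fine_expectation_sum _ (index_enum 'I_n) (mem S) (G i) (L1G i).
apply: eq_bigr => j _.
by rewrite expectationZl ?Lfun2_mul_Lfun1// fineM ?expectation_fin_num ?Lfun2_mul_Lfun1.
Qed.

End SecondMoments.

(** * Comparison of the two objectives and the greedy guarantee *)

Section DictionarySelection.
Context (disp : measure_display) (T : measurableType disp) (R : realType).
Context (P : probability T R) (n s k : nat).
Context (X : 'I_n -> {RV P >-> R}) (Z : 'I_s -> {RV P >-> R}).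
Hypothesis X_mean : forall i, ('E_P[X i] = 0)%E.
Hypothesis X_var : forall i, ('V_P[X i] = 1)%E.
Hypothesis Z_mean : forall j, ('E_P[Z j] = 0)%E.
Hypothesis Z_var : forall j, ('V_P[Z j] = 1)%E.

Let L2X i : (X i : T -> R) \in Lfun P 2%:E.
Proof. exact: Lfun2_standardized. Qed.

Let L2Z j : (Z j : T -> R) \in Lfun P 2%:E.
Proof. exact: Lfun2_standardized. Qed.

Let cov_mxE i i' : cov_mx X i i' = moment2 P (X i) (X i').
Proof. by rewrite mxE covariance_centered. Qed.

Lemma cov_mx_sym i i' : cov_mx X i i' = cov_mx X i' i.
Proof. by rewrite !mxE covarianceC. Qed.

Lemma cov_mx_diag i : cov_mx X i i = 1.
Proof. by rewrite mxE -/('V_P[X i])%E X_var. Qed.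

Let qform_covE (S : {set 'I_n}) v : qform (cov_mx X) S v =
  \sum_(i in S) \sum_(i' in S) v i * v i' * moment2 P (X i) (X i').
Proof. by apply: eq_bigr => i _; apply: eq_bigr => i' _; rewrite cov_mxE. Qed.

(** For the zero target, the mean squared error is exactly the quadratic form. *)
Lemma cov_mx_psd (v : 'I_n -> R) : 0 <= qform (cov_mx X) [set: 'I_n] v.
Proof.
have := @mean_sq_err_expand _ _ _ P _ (fun i => X i : T -> R) (cst 0)
  [set: 'I_n] v L2X (Lfun_cst _ _ _).
have moment0 (Y : T -> R) : moment2 P (cst 0) Y = 0.
  rewrite /moment2 (_ : cst 0 \* Y = cst 0) ?expectation_cst//.
  by apply/funext => w /=; rewrite mul0r.
rewrite moment0 [X in _ - 2 * X]big1 => [|i _]; last by rewrite moment0 mulr0.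
rewrite mulr0 subr0 add0r => err.
by rewrite qform_covE -err fine_ge0// expectation_ge0// => w; rewrite sqr_ge0.
Qed.

Let b j i : R := moment2 P (Z j) (X i).

Lemma mean_sq_errE j (S : {set 'I_n}) alpha :
  mean_sq_err X (Z j) S alpha = lsq_err (cov_mx X) (b j) S alpha.
Proof.
rewrite /mean_sq_err mean_sq_err_expand// /lsq_err qform_covE.
by rewrite /moment2 -covariance_centered// -/('V_P[Z j])%E Z_var.
Qed.

Lemma sq_mult_corrE j (S : {set 'I_n}) :
  sq_mult_corr X (Z j) S = 1 - inf (range (lsq_err (cov_mx X) (b j) S)).
Proof.
rewrite /sq_mult_corr (_ : mean_sq_err _ _ _ = lsq_err (cov_mx X) (b j) S)//.
by apply/funext => alpha; exact: mean_sq_errE.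
Qed.

Lemma sq_mult_corr_ge (lam : R) j (S : {set 'I_n}) : 0 < lam ->
  (forall v, qform (cov_mx X) S v <= lam * \sum_(i in S) v i ^+ 2) ->
  (\sum_(i in S) b j i ^+ 2) / lam <= sq_mult_corr X (Z j) S.
Proof.
move=> lam_gt0 q_le; rewrite sq_mult_corrE; apply: lsq_gain_ge => // alpha.
rewrite -mean_sq_errE /mean_sq_err.
by rewrite fine_ge0// expectation_ge0// => w; rewrite sqr_ge0.
Qed.

Lemma sq_mult_corr_le (lam : R) j (S : {set 'I_n}) : 0 < lam ->
  (forall v, lam * (\sum_(i in S) v i ^+ 2) <= qform (cov_mx X) S v) ->
  sq_mult_corr X (Z j) S <= (\sum_(i in S) b j i ^+ 2) / lam.
Proof. by move=> *; rewrite sq_mult_corrE; exact: lsq_gain_le. Qed.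

(** On a singleton the form is the square itself, so the upper and lower bounds with [lam = 1]
    coincide. *)
Lemma sq_mult_corr1 j i : sq_mult_corr X (Z j) [set i]%SET = b j i ^+ 2.
Proof.
have q1 v : qform (cov_mx X) [set i]%SET v = 1 * \sum_(i' in [set i]%SET) v i' ^+ 2.
  by rewrite /qform !big_set1 cov_mx_diag; lra.
apply/le_anti/andP; split.
  have := @sq_mult_corr_le 1 j [set i]%SET ltr01; rewrite big_set1 divr1; apply.
  by move=> v; rewrite q1.
have := @sq_mult_corr_ge 1 j [set i]%SET ltr01; rewrite big_set1 divr1; apply.
by move=> v; rewrite q1.
Qed.

Hypotheses (k_gt0 : (0 < k)%N) (le_kn : (k <= n)%N).
Hypothesis C_unit : cov_mx X \in unitmx.

Local Notation lmin := (sparse_lambda_min (cov_mx X) k).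
Local Notation lmax := (sparse_lambda_max (cov_mx X) k).
Local Notation gamma := (submod_ratio_multi X Z k).
Local Notation w j := (fun i => sq_mult_corr X (Z j) [set i]%SET).
Local Notation F := (dict_obj X Z k).
Local Notation Fhat := (dict_obj_modular X Z k).

Lemma sparse_lambda_min_cov_gt0 : 0 < lmin.
Proof.
apply: sparse_lambda_min_gt0 => //; [exact: cov_mx_sym | exact: cov_mx_psd].
Qed.

Lemma sparse_lambda_max_cov_gt0 : 0 < lmax.
Proof.
apply: lt_le_trans ltr01 _.
apply: sparse_lambda_max_ge1 => //; [exact: cov_mx_sym | exact: cov_mx_diag].
Qed.

Let w_ge0 j i : 0 <= sq_mult_corr X (Z j) [set i]%SET.
Proof. by rewrite sq_mult_corr1 sqr_ge0. Qed.

Lemma sum_sq_corr_le j (S : {set 'I_n}) : (#|S| <= k)%N ->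
  (\sum_(i in S) sq_mult_corr X (Z j) [set i]%SET) / lmax <= sq_mult_corr X (Z j) S.
Proof.
move=> cS; under eq_bigr do rewrite sq_mult_corr1.
apply: sq_mult_corr_ge; first exact: sparse_lambda_max_cov_gt0.
by move=> v; apply: qform_le_sparse => //; exact: cov_mx_sym.
Qed.

Lemma sum_sq_corr_ge j (S : {set 'I_n}) : (#|S| <= k)%N ->
  lmin * sq_mult_corr X (Z j) S <= \sum_(i in S) sq_mult_corr X (Z j) [set i]%SET.
Proof.
move=> cS; under eq_bigr do rewrite sq_mult_corr1.
rewrite mulrC -ler_pdivlMr ?sparse_lambda_min_cov_gt0//.
apply: sq_mult_corr_le; first exact: sparse_lambda_min_cov_gt0.
by move=> v; apply: qform_ge_sparse => //; exact: cov_mx_sym.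
Qed.

Lemma sq_mult_corr_ge0 j (S : {set 'I_n}) : (#|S| <= k)%N ->
  0 <= sq_mult_corr X (Z j) S.
Proof.
move=> /(sum_sq_corr_le j); apply: le_trans.
by rewrite divr_ge0 ?sumr_ge0// ltW// sparse_lambda_max_cov_gt0.
Qed.

Let ratio j (S : {set 'I_n}) : R :=
  quot00 (\sum_(i in S) sq_mult_corr X (Z j) [set i]%SET) (sq_mult_corr X (Z j) S).

Let small_sets_neq0 : [set S : {set 'I_n} | (#|S| <= k)%N] !=set0.
Proof. by exists finset.set0; rewrite /= cards0. Qed.

Lemma submod_ratio_le j (S : {set 'I_n}) : (#|S| <= k)%N ->
  gamma * sq_mult_corr X (Z j) S <= \sum_(i in S) sq_mult_corr X (Z j) [set i]%SET.
Proof.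
move=> cS; have [r0|r_neq0] := eqVneq (sq_mult_corr X (Z j) S) 0.
  by rewrite r0 mulr0 sumr_ge0.
have r_gt0 : 0 < sq_mult_corr X (Z j) S by rewrite lt_def r_neq0 sq_mult_corr_ge0.
rewrite -ler_pdivlMr//.
have [j0 [_ gammaE le_gamma]] :=
  inf_finite (fun j => submod_ratio X (Z j) k) (ex_intro setT j I).
rewrite /submod_ratio_multi gammaE; apply: le_trans (le_gamma j I) _.
have [S0 [_ gammajE le_gammaj]] := inf_finite (ratio j) small_sets_neq0.
rewrite /submod_ratio gammajE; apply: le_trans (le_gammaj S cS) _.
by rewrite /ratio /quot00 (negPf r_neq0) andbF.
Qed.

(** The argument [j] ensures that there is a target, so that the infimum defining [gamma] is
    attained. *)
Lemma submod_ratio_ge (j : 'I_s) : lmin <= gamma.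
Proof.
have [j0 [_ gammaE _]] :=
  inf_finite (fun j => submod_ratio X (Z j) k) (ex_intro setT j I).
rewrite /submod_ratio_multi gammaE.
have [S [/= cS gammajE _]] := inf_finite (ratio j0) small_sets_neq0.
rewrite /submod_ratio gammajE /ratio /quot00; case: ifPn => [_|].
  (* The convention 0/0 = 1 is met by [lmin <= 1]. *)
  by apply: sparse_lambda_min_le1 => //; [exact: cov_mx_sym | exact: cov_mx_diag].
rewrite negb_and => neq0.
(* A vanishing denominator forces the numerator to vanish, through the bound with [lmax]; that case
   is already excluded. *)
have [r0|r_neq0] := eqVneq (sq_mult_corr X (Z j0) S) 0.
  move: neq0; rewrite r0 eqxx orbF => /negP[].
  rewrite eq_le sumr_ge0// andbT.
  have := sum_sq_corr_le j0 cS; rewrite r0 ler_pdivrMr ?mul0r//.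
  exact: sparse_lambda_max_cov_gt0.
rewrite ler_pdivlMr ?sum_sq_corr_ge//.
by rewrite lt_def r_neq0 sq_mult_corr_ge0.
Qed.

Lemma dict_obj_modularE D : Fhat D = \sum_(j < s) modular_max k (w j) D.
Proof. by []. Qed.

Lemma dict_obj_modular_ge0 D : 0 <= Fhat D.
Proof.
rewrite dict_obj_modularE sumr_ge0// => j _.
apply: (@le_trans _ _ (\sum_(i in finset.set0) sq_mult_corr X (Z j) [set i]%SET)).
  by rewrite big_set0.
by apply: modular_max_ge; rewrite ?finset.sub0set ?cards0.
Qed.

Lemma dict_obj_ge0 D : 0 <= F D.
Proof.
rewrite sumr_ge0// => j _.
have [S [/candidates_card[_ cS] -> _]] :=
  sup_finite (fun S : {set 'I_n} => sq_mult_corr X (Z j) S) (candidates_neq0 k D).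
exact: sq_mult_corr_ge0.
Qed.

Lemma dict_obj_ge_modular D : Fhat D / lmax <= F D.
Proof.
rewrite mulr_suml; apply: ler_sum => j _.
have [S [candS -> _]] :=
  sup_finite (fun S : {set 'I_n} => \sum_(i in S) sq_mult_corr X (Z j) [set i]%SET)
    (candidates_neq0 k D).
have [_ cS] := candidates_card candS.
apply: le_trans (sum_sq_corr_le j cS) _.
have [S' [_ -> max_S']] :=
  sup_finite (fun S : {set 'I_n} => sq_mult_corr X (Z j) S) (candidates_neq0 k D).
exact: max_S'.
Qed.

Lemma dict_obj_modular_ge D : gamma * F D <= Fhat D.
Proof.
rewrite mulr_sumr; apply: ler_sum => j _.
have [S [/candidates_card[sSD cS] -> _]] :=
  sup_finite (fun S : {set 'I_n} => sq_mult_corr X (Z j) S) (candidates_neq0 k D).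
apply: le_trans (submod_ratio_le j cS) _.
exact: (modular_max_ge (w_ge0 j)).
Qed.

(** Monotonicity and the gain inequality are preserved by sums, so they pass from each target to
    [Fhat]. *)
Lemma dict_obj_modular_greedy (d : nat) (D D' : {set 'I_n}) :
  (0 < d)%N -> (#|D'| <= d)%N ->
  SDS_MA_output X Z k d D -> (1 - 1 / expR 1) * Fhat D' <= Fhat D.
Proof.
move=> d_gt0 cD' outD; apply: (greedy_approx _ _ d_gt0 cD') => //.
- move=> A m; rewrite !dict_obj_modularE; apply: ler_sum => j _.
  exact: modular_max_mono.
- move=> A A'; rewrite !dict_obj_modularE -sumrB.
  under [leRHS]eq_bigr do rewrite !dict_obj_modularE -sumrB.
  rewrite exchange_big; apply: ler_sum => j _; exact: modular_max_gain.
- exact: dict_obj_modular_ge0.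
(* The only candidate within the empty dictionary is the empty set. *)
suff -> : Fhat finset.set0 = 0 by exact: dict_obj_modular_ge0.
rewrite dict_obj_modularE big1// => j _.
have [S [/candidates_card[+ _] FE _]] :=
  sup_finite (fun S : {set 'I_n} => \sum_(i in S) sq_mult_corr X (Z j) [set i]%SET)
    (candidates_neq0 k finset.set0).
by rewrite finset.subset0 /modular_max FE => /eqP->; rewrite big_set0.
Qed.

End DictionarySelection.

Theorem theorem4p2 (disp : measure_display) (T : measurableType disp)
    (R : realType) (P : probability T R) (n s k d : nat)
    (X : 'I_n -> {RV P >-> R}) (Z : 'I_s -> {RV P >-> R})
    (X_mean : forall i : 'I_n, ('E_P[X i] = 0)%E)
    (X_var : forall i : 'I_n, ('V_P[X i] = 1)%E)
    (Z_mean : forall j : 'I_s, ('E_P[Z j] = 0)%E)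
    (Z_var : forall j : 'I_s, ('V_P[Z j] = 1)%E)
    (C_nonsingular : cov_mx X \in unitmx)
    (k_ge1 : (1 <= k)%N) (k_lt_d : (k < d)%N) (d_le_n : (d <= n)%N)
    (D_MA D_opt : {set 'I_n})
    (D_MA_output : SDS_MA_output X Z k d D_MA)
    (D_opt_optimal : optimal_dict X Z k d D_opt) :
  dict_obj X Z k D_MA >=
    submod_ratio_multi X Z k / sparse_lambda_max (cov_mx X) k
      * (1 - 1 / expR 1) * dict_obj X Z k D_opt
  /\
  submod_ratio_multi X Z k / sparse_lambda_max (cov_mx X) k
      * (1 - 1 / expR 1) * dict_obj X Z k D_opt >=
    sparse_lambda_min (cov_mx X) k / sparse_lambda_max (cov_mx X) k
      * (1 - 1 / expR 1) * dict_obj X Z k D_opt.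
Proof.
have k_le_n : (k <= n)%N by rewrite (leq_trans (ltnW k_lt_d)).
have lmax_gt0 : 0 < sparse_lambda_max (cov_mx X) k.
  exact: sparse_lambda_max_cov_gt0.
have e_ge0 : 0 <= 1 - 1 / expR 1 :> R.
  by rewrite subr_ge0 div1r -expRN expR_le1 oppr_le0.
have F_ge0 : 0 <= dict_obj X Z k D_opt by exact: dict_obj_ge0.
split.
  have le_MA : dict_obj_modular X Z k D_MA / sparse_lambda_max (cov_mx X) k
      <= dict_obj X Z k D_MA by exact: dict_obj_ge_modular.
  have le_opt : submod_ratio_multi X Z k * dict_obj X Z k D_opt
      <= dict_obj_modular X Z k D_opt by exact: dict_obj_modular_ge.
  have d_gt0 : (0 < d)%N by exact: leq_ltn_trans k_lt_d.
  have le_greedy : (1 - 1 / expR 1) * dict_obj_modular X Z k D_opt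
      <= dict_obj_modular X Z k D_MA.
    by case: D_opt_optimal => cD _; exact: dict_obj_modular_greedy D_MA_output.
  (* Chain [F D_MA >= Fhat D_MA / lmax], then the greedy factor, then
     [Fhat D_opt >= gamma * F D_opt]. *)
  apply: le_trans le_MA; rewrite ler_pdivlMr//.
  apply: le_trans le_greedy; apply: le_trans (ler_wpM2l e_ge0 le_opt).
  rewrite [leLHS](_ : _ = (1 - 1 / expR 1) *
    (submod_ratio_multi X Z k * dict_obj X Z k D_opt) *
    ((sparse_lambda_max (cov_mx X) k)^-1 * sparse_lambda_max (cov_mx X) k)).
    by rewrite mulVf ?mulr1// gt_eqF.
  by lra.
case: s Z Z_mean Z_var {D_MA_output D_opt_optimal} F_ge0 => [|s'] Z' Z'_mean Z'_var F_ge0.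
  by rewrite /dict_obj big_ord0 !mulr0.
rewrite !ler_wpM2r//; first by rewrite invr_ge0 ltW.
exact: (submod_ratio_ge X_mean X_var Z'_mean Z'_var k_ge1 k_le_n C_nonsingular ord0).
Qed.
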